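(* Let $\mathcal M=(M,d,(q_i))$ be a computable metric space and $x\in M$. Then $x$ is computable if and only if $x$ is locally $C$-trivial, i.e. there is $b\in\mathbb N$ such that for every $n$ there is a special point $p$ with $d(x,p)<2^{-n}$ and $C(p,n)\le C(n)+b$.
   Context: $C$ denotes plain Kolmogorov complexity, $C(p,n)$ the plain complexity of the pair $\langle p,n\rangle$. A computable metric space is a complete separable metric space with a dense sequence of special points $(q_i)$ (identified with $i\in\mathbb N$) such that $d(q_i,q_k)$ is computable uniformly in $i,k$. A point is computable if it has a computable Cauchy name, i.e. a computable $\alpha:\mathbb N\to\mathbb N$ with $d(q_{\alpha(s)},q_{\alpha(t)})\le 2^{-s}$ for $t\ge s$ and $\lim_sq_{\alpha(s)}=x$. *)

(* Defs.v *)
From Stdlib Require Import Reals List Arith ClassicalEpsilon.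
Import ListNotations.
Open Scope R_scope.

Inductive prf : Type :=
| pZero : prf
| pSucc : prf
| pProj : nat -> prf
| pComp : prf -> list prf -> prf
| pRec  : prf -> prf -> prf
| pMu   : prf -> prf.

(* Big-step evaluation relation; missing arguments default to 0. *)
Inductive eval : prf -> list nat -> nat -> Prop :=
| ev_zero : forall v, eval pZero v 0
| ev_succ : forall v, eval pSucc v (S (hd 0%nat v))
| ev_proj : forall i v, eval (pProj i) v (nth i v 0%nat)
| ev_comp : forall f gs v ys y,
    Forall2 (fun g yv => eval g v yv) gs ys -> eval f ys y -> eval (pComp f gs) v y
| ev_rec0 : forall f g v y, eval f v y -> eval (pRec f g) (0%nat :: v) y
| ev_recS : forall f g n v r y,
    eval (pRec f g) (n :: v) r -> eval g (n :: r :: v) y ->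
    eval (pRec f g) (S n :: v) y
| ev_mu : forall f v n,
    eval f (n :: v) 0%nat ->
    (forall m, (m < n)%nat -> exists k, eval f (m :: v) (S k)) ->
    eval (pMu f) v n.

Definition computable1 (g : nat -> nat) : Prop :=
  exists f, forall n, eval f [n] (g n).
Definition computable3 (g : nat -> nat -> nat -> nat) : Prop :=
  exists f, forall i k s, eval f [i; k; s] (g i k s).

(* Bijective coding of binary strings by naturals. *)
Fixpoint code (s : list bool) : nat :=
  match s with
  | [] => 0%nat
  | b :: s' => (2 * code s' + 1 + (if b then 1 else 0))%nat
  end.

(* A machine is the graph of a partial function {0,1}^* -> N. *)
Definition machine := list bool -> nat -> Prop.

Definition partial_computable (V : machine) : Prop :=
  exists f, forall s y, V s y <-> eval f [code s] y.

Definition optimal (U : machine) : Prop :=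
  partial_computable U /\
  forall V, partial_computable V ->
    exists c : nat, forall s y, V s y ->
      exists t, U t y /\ (length t <= length s + c)%nat.

Definition is_C_value (U : machine) (x k : nat) : Prop :=
  (exists s, U s x /\ length s = k) /\ (forall s, U s x -> (k <= length s)%nat).

Definition C (U : machine) (x : nat) : nat :=
  epsilon (inhabits 0%nat) (is_C_value U x).

(* Cantor pairing <p,n>. *)
Definition pair (p n : nat) : nat := ((p + n) * (p + n + 1) / 2 + n)%nat.

Definition computable_metric_space (M : Type) (d : M -> M -> R) (q : nat -> M) : Prop :=
  (forall x y, 0 <= d x y) /\
  (forall x y, d x y = 0 <-> x = y) /\
  (forall x y, d x y = d y x) /\
  (forall x y z, d x z <= d x y + d y z) /\
  (forall u : nat -> M,
     (forall eps, 0 < eps -> exists N, forall m n, (N <= m)%nat -> (N <= n)%nat -> d (u m) (u n) < eps) ->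
     exists l, forall eps, 0 < eps -> exists N, forall n, (N <= n)%nat -> d (u n) l < eps) /\
  (forall x eps, 0 < eps -> exists i, d x (q i) < eps) /\
  (exists a c : nat -> nat -> nat -> nat,
     computable3 a /\ computable3 c /\
     forall i k s, Rabs (d (q i) (q k) - INR (a i k s) / INR (S (c i k s))) <= (/2) ^ s).

Definition computable_point (M : Type) (d : M -> M -> R) (q : nat -> M) (x : M) : Prop :=
  exists alpha : nat -> nat, computable1 alpha /\
    (forall s t, (s <= t)%nat -> d (q (alpha s)) (q (alpha t)) <= (/2) ^ s) /\
    (forall eps, 0 < eps -> exists N, forall s, (N <= s)%nat -> d (q (alpha s)) x < eps).

Definition locally_C_trivial (U : machine) (M : Type) (d : M -> M -> R) (q : nat -> M) (x : M) : Prop :=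
  exists b : nat, forall n : nat, exists p : nat,
    d x (q p) < (/2) ^ n /\ (C U (pair p n) <= C U n + b)%nat.

(* Main.v *)
Require Import Defs.
From Stdlib Require Import Reals List Arith Classical ClassicalEpsilon Lia Lra Cantor.
(* [Reals] also exports a constant [C]. *)
Import Defs ListNotations.
Open Scope nat_scope.

(** If a computable [alpha] converges to [x], a program for [n] computes [<alpha (n+1), n>].

    Conversely [C(n) <= m + O(1)] for [n < 2^(m+1)], so every [n] of block [m], i.e. with
    [2^m <= n < 2^(m+1)], has a program [j < 2^(m+b)] for some [<p,n>] with [d(x,p) < 2^-n].
    Let [W(e,m)] be the set of programs [j < 2^(m+b)] that output some [<p,n>] with [n] in
    block [m] and [d(x,p) < 2^-e], and let [K <= 2^b] be maximal such that for each [e] there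
    are infinitely many [m] with [#W(e,m) >= K 2^m]. Then for some [e0], [#W(e0,m) < (K+1) 2^m]
    for all large [m]. Fix a small ball [B] about a special point with [x] in [B] and [B]
    inside [B(x,2^-e0)]. To approximate [x] up to [2^-s], search for a large [m] and a ball
    [B'] of radius [2^-s] about a special point such that at least [K 2^m] programs are seen
    to output [<p,n>] with [n] in block [m] and [p] in [B] and [B']. The search succeeds by
    the choice of [K]. Fewer than [2^m] elements of [W(e0,m)] have not been seen, so some [n]
    in block [m] has its program for an approximation of [x] among those seen, hence [x] is
    within [2^-n] of [B']. *)

(** * Induction on programs and determinism of evaluation *)

(** The automatically generated principle gives no hypothesis for the list of programs inside
    [pComp]. *)
Lemma prf_nested_ind (P : prf -> Prop) :
  P pZero -> P pSucc -> (forall i, P (pProj i)) ->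
  (forall f gs, P f -> Forall P gs -> P (pComp f gs)) ->
  (forall f g, P f -> P g -> P (pRec f g)) ->
  (forall f, P f -> P (pMu f)) ->
  forall f, P f.
Proof.
  intros H0 HS Hp Hc Hr Hm.
  fix IH 1; intros [| | i | f gs | f g | f].
  - exact H0.
  - exact HS.
  - apply Hp.
  - apply Hc; [apply IH |].
    induction gs as [| g gs IHgs]; constructor; [apply IH | exact IHgs].
  - apply Hr; apply IH.
  - apply Hm; apply IH.
Qed.

Lemma eval_functional (f : prf) :
  forall v y1 y2, eval f v y1 -> eval f v y2 -> y1 = y2.
Proof.
  induction f as [| | i | f gs IHf IHgs | f g IHf IHg | f IHf] using prf_nested_ind;
    intros v y1 y2 H1 H2.
  - inversion H1; inversion H2; congruence.
  - inversion H1; inversion H2; congruence.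
  - inversion H1; inversion H2; congruence.
  - inversion H1 as [| | | ? ? ? ys1 ? F1 E1 | | |]; subst.
    inversion H2 as [| | | ? ? ? ys2 ? F2 E2 | | |]; subst.
    assert (ys1 = ys2) as <-; [| eapply IHf; eassumption].
    clear - IHgs F1 F2. revert ys2 F2.
    induction F1 as [| g y gs ys1 Hg F1 IH]; intros ys2 F2; inversion F2; subst; [easy |].
    inversion IHgs; subst. f_equal; eauto.
  - destruct v as [| n v]; [inversion H1 |].
    revert y1 y2 H1 H2; induction n as [| n IHn]; intros y1 y2 H1 H2.
    + inversion H1; inversion H2; subst; eauto.
    + inversion H1 as [| | | | | ? ? ? ? r1 ? R1 G1 |]; subst.
      inversion H2 as [| | | | | ? ? ? ? r2 ? R2 G2 |]; subst.
      rewrite (IHn _ _ R1 R2) in G1. eauto.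
  - inversion H1 as [| | | | | | ? ? ? Z1 L1]; subst.
    inversion H2 as [| | | | | | ? ? ? Z2 L2]; subst.
    (* If one result were smaller, the other evaluation would make [f] positive there, where it is
       zero. *)
    destruct (lt_eq_lt_dec y1 y2) as [[Hlt | ->] | Hlt]; [| reflexivity |].
    + destruct (L2 _ Hlt) as [k Hk]. specialize (IHf _ _ _ Z1 Hk). discriminate.
    + destruct (L1 _ Hlt) as [k Hk]. specialize (IHf _ _ _ Z2 Hk). discriminate.
Qed.

(** * Closure properties of total recursive functions *)

(** [F] takes the whole argument list, so that the closure lemmas apply directly to the body of a
    function; its values on lists of other lengths do not matter. *)
Definition recursive (k : nat) (F : list nat -> nat) : Prop :=
  exists f, forall v, length v = k -> eval f v (F v).

Lemma recursive_ext (k : nat) (F G : list nat -> nat) :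
  (forall v, length v = k -> F v = G v) -> recursive k F -> recursive k G.
Proof.
  intros E [f Hf]. exists f. intros v Hv. rewrite <- E by exact Hv. auto.
Qed.

Lemma recursive_nth (k i : nat) : recursive k (fun v => nth i v 0).
Proof. exists (pProj i). intros v _. constructor. Qed.

Lemma recursive_comp (k : nat) (Fs : list (list nat -> nat)) (G : list nat -> nat) :
  Forall (recursive k) Fs -> recursive (length Fs) G ->
  recursive k (fun v => G (map (fun F => F v) Fs)).
Proof.
  intros HF [g Hg].
  assert (exists fs, forall v, length v = k ->
            Forall2 (fun f y => eval f v y) fs (map (fun F => F v) Fs)) as [fs Hfs].
  { clear Hg. induction HF as [| F Fs [f Hf] HF [fs Hfs]].
    - exists []. constructor.
    - exists (f :: fs). intros v Hv. constructor; auto. }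
  exists (pComp g fs). intros v Hv.
  apply ev_comp with (map (fun F => F v) Fs); [auto |].
  apply Hg. apply length_map.
Qed.

Lemma map_nth_seq (v : list nat) : map (fun i => nth i v 0) (seq 0 (length v)) = v.
Proof.
  induction v as [| x v IH]; [reflexivity |].
  cbn [length seq map nth]. f_equal. rewrite <- seq_shift, map_map. exact IH.
Qed.

Lemma map_nth_seq_cons (x : nat) (v : list nat) :
  map (fun i => nth i (x :: v) 0) (seq 1 (length v)) = v.
Proof. rewrite <- seq_shift, map_map. apply map_nth_seq. Qed.

Lemma recursive_reindex (k : nat) (js : list nat) (F : list nat -> nat) :
  recursive (length js) F -> recursive k (fun v => F (map (fun i => nth i v 0) js)).
Proof.
  intros HF.
  apply recursive_ext
    with (fun v => F (map (fun G => G v) (map (fun i v => nth i v 0) js))).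
  - intros v _. now rewrite map_map.
  - apply recursive_comp; [| now rewrite length_map].
    apply Forall_map, Forall_forall. intros i _. apply recursive_nth.
Qed.

Lemma recursive_tl (k : nat) (F : list nat -> nat) :
  recursive k F -> recursive (S k) (fun v => F (tl v)).
Proof.
  intros HF.
  apply recursive_ext with (fun v => F (map (fun i => nth i v 0) (seq 1 k))).
  - intros [| x v] Hv; [discriminate |]. injection Hv as <-.
    now rewrite map_nth_seq_cons.
  - apply recursive_reindex. now rewrite length_seq.
Qed.

(** Inserts a dummy variable: the accumulator in [recursive_bsum], the recursion argument in
    [stages_rec]. *)
Lemma recursive_skip_second (k : nat) (F : nat -> list nat -> nat) :
  recursive (S k) (fun w => F (hd 0 w) (tl w)) ->
  recursive (S (S k)) (fun w => F (hd 0 w) (tl (tl w))).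
Proof.
  intros HF.
  apply recursive_ext with
    (fun v => (fun w => F (hd 0 w) (tl w)) (map (fun i => nth i v 0) (0 :: seq 2 k))).
  - intros [| x [| y v]] Hv; try discriminate. injection Hv as <-.
    cbn [map hd tl nth]. f_equal. rewrite <- (map_nth_seq_cons y v) at 2.
    now rewrite <- (seq_shift _ 1), map_map.
  - apply (recursive_reindex _ (0 :: seq 2 k) (fun w => F (hd 0 w) (tl w))). cbn. now rewrite length_seq.
Qed.

Lemma recursive_const (k c : nat) : recursive k (fun _ => c).
Proof.
  induction c as [| c [f Hf]].
  - exists pZero. constructor.
  - exists (pComp pSucc [f]). intros v Hv.
    apply ev_comp with [c]; [repeat constructor; auto | apply (ev_succ [c])].
Qed.

Lemma recursive_cons (k : nat) (A : list nat -> nat) (G : nat -> list nat -> nat) :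
  recursive k A -> recursive (S k) (fun w => G (hd 0 w) (tl w)) ->
  recursive k (fun v => G (A v) v).
Proof.
  intros HA HG.
  apply recursive_ext
    with (fun v => (fun w => G (hd 0 w) (tl w))
       (map (fun F => F v) (A :: map (fun i v => nth i v 0) (seq 0 k)))).
  - intros v <-. cbn. rewrite map_map. now rewrite map_nth_seq.
  - apply (recursive_comp k (A :: map (fun i v => nth i v 0) (seq 0 k))
             (fun w => G (hd 0 w) (tl w))).
    + constructor; [exact HA |].
      apply Forall_map, Forall_forall. intros i _. apply recursive_nth.
    + cbn. now rewrite length_map, length_seq.
Qed.

Lemma recursive_app1 (k : nat) (G : nat -> nat) (A : list nat -> nat) :
  recursive 1 (fun v => G (nth 0 v 0)) ->
  recursive k A -> recursive k (fun v => G (A v)).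
Proof. intros HG HA. now apply (recursive_comp k [A] _ ltac:(repeat constructor; auto) HG). Qed.

Lemma recursive_app2 (k : nat) (G : nat -> nat -> nat) (A B : list nat -> nat) :
  recursive 2 (fun v => G (nth 0 v 0) (nth 1 v 0)) ->
  recursive k A -> recursive k B -> recursive k (fun v => G (A v) (B v)).
Proof. intros HG HA HB. now apply (recursive_comp k [A; B] _ ltac:(repeat constructor; auto) HG). Qed.

Lemma recursive_app3 (k : nat) (G : nat -> nat -> nat -> nat) (A B D : list nat -> nat) :
  recursive 3 (fun v => G (nth 0 v 0) (nth 1 v 0) (nth 2 v 0)) ->
  recursive k A -> recursive k B -> recursive k D ->
  recursive k (fun v => G (A v) (B v) (D v)).
Proof. intros HG HA HB HD. now apply (recursive_comp k [A; B; D] _ ltac:(repeat constructor; auto) HG). Qed.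

Lemma recursive_app4 (k : nat) (G : nat -> nat -> nat -> nat -> nat)
    (A B D E : list nat -> nat) :
  recursive 4 (fun v => G (nth 0 v 0) (nth 1 v 0) (nth 2 v 0) (nth 3 v 0)) ->
  recursive k A -> recursive k B -> recursive k D -> recursive k E ->
  recursive k (fun v => G (A v) (B v) (D v) (E v)).
Proof.
  intros HG HA HB HD HE.
  now apply (recursive_comp k [A; B; D; E] _ ltac:(repeat constructor; auto) HG).
Qed.

Lemma recursive_rec (k : nat) (N B : list nat -> nat) (St : nat -> nat -> list nat -> nat) :
  recursive k N -> recursive k B ->
  recursive (S (S k)) (fun w => St (hd 0 w) (hd 0 (tl w)) (tl (tl w))) ->
  recursive k (fun v => nat_rec (fun _ => nat) (B v) (fun n r => St n r v) (N v)).
Proof.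
  intros HN [b Hb] [st Hst].
  (* [pRec] recurses on its first argument, so the computed bound is first put at the head of the
     list. *)
  apply (recursive_cons k N (fun n v => nat_rec (fun _ => nat) (B v) (fun n r => St n r v) n) HN).
  exists (pRec b st). intros [| n v] Hv; [discriminate |]. injection Hv as Hv. cbn.
  induction n as [| n IH]; cbn.
  - constructor. auto.
  - eapply ev_recS; [exact IH |]. apply Hst. cbn. congruence.
Qed.

Lemma recursive_mu (k : nat) (F : list nat -> nat) :
  recursive (S k) F -> (forall v, length v = k -> exists n, F (n :: v) = 0) ->
  exists h, recursive k h /\ forall v, length v = k -> F (h v :: v) = 0.
Proof.
  intros [f Hf] Hex.
  assert (forall v, exists y, length v = k -> eval (pMu f) v y /\ F (y :: v) = 0) as H.
  { intros v. destruct (Nat.eq_dec (length v) k) as [Hv |]; [| now exists 0].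
    destruct (Hex v Hv) as [n Hn].
    (* The least zero is the value of [pMu f]: [F] is total, so [f] converges to a successor at
       every smaller argument. *)
    destruct (dec_inh_nat_subset_has_unique_least_element (fun n => F (n :: v) = 0))
      as (y & [Hy Hmin] & _); [intros; lia | eauto |].
    exists y. intros _. split; [| exact Hy]. constructor.
    - rewrite <- Hy. apply Hf. cbn. congruence.
    - intros m Hm. exists (pred (F (m :: v))).
      replace (S (pred (F (m :: v)))) with (F (m :: v)).
      + apply Hf. cbn. congruence.
      + destruct (F (m :: v)) eqn:E; [specialize (Hmin m E); lia | reflexivity]. }
  exists (fun v => proj1_sig (constructive_indefinite_description _ (H v))).
  split; [exists (pMu f) |]; intros v Hv;
    destruct (constructive_indefinite_description _ (H v)) as [y Hy]; cbn; now apply Hy.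
Qed.

(** * Arithmetic *)

Lemma recursive_S (k : nat) (A : list nat -> nat) :
  recursive k A -> recursive k (fun v => S (A v)).
Proof.
  apply recursive_app1. exists pSucc. intros v Hv.
  replace (nth 0 v 0) with (hd 0 v) by now destruct v. constructor.
Qed.

(** A composite of [hd], [tl] and [nth] agrees with a projection on short lists too, every default
    being 0; splitting the list far enough makes both sides reduce. *)
Ltac recursive_variable_at j :=
  apply recursive_ext with (fun v => nth j v 0);
  [ intros v _; do 9 (destruct v; [reflexivity |]); reflexivity | apply recursive_nth ].

Ltac recursive_variable :=
  first [ apply recursive_const
        | recursive_variable_at 0 | recursive_variable_at 1 | recursive_variable_at 2
        | recursive_variable_at 3 | recursive_variable_at 4 | recursive_variable_at 5
        | recursive_variable_at 6 | recursive_variable_at 7 | recursive_variable_at 8 ].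

Lemma recursive_pred (k : nat) (A : list nat -> nat) :
  recursive k A -> recursive k (fun v => pred (A v)).
Proof.
  apply recursive_app1.
  apply recursive_ext with
    (fun v => nat_rec (fun _ => nat) 0 (fun n _ => n) (nth 0 v 0)).
  - intros v _. now destruct (nth 0 v 0).
  - apply (recursive_rec 1 _ _ (fun n _ _ => n)); recursive_variable.
Qed.

Lemma recursive_add (k : nat) (A B : list nat -> nat) :
  recursive k A -> recursive k B -> recursive k (fun v => A v + B v).
Proof.
  apply recursive_app2.
  apply recursive_ext with
    (fun v => nat_rec (fun _ => nat) (nth 1 v 0) (fun _ r => S r) (nth 0 v 0)).
  - intros v _. induction (nth 0 v 0); cbn; congruence.
  - apply (recursive_rec 2 _ _ (fun _ r _ => S r)); try apply recursive_S; recursive_variable.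
Qed.

Lemma recursive_mul (k : nat) (A B : list nat -> nat) :
  recursive k A -> recursive k B -> recursive k (fun v => A v * B v).
Proof.
  apply recursive_app2.
  apply recursive_ext with
    (fun v => nat_rec (fun _ => nat) 0 (fun _ r => nth 1 v 0 + r) (nth 0 v 0)).
  - intros v _. induction (nth 0 v 0); cbn; congruence.
  - apply (recursive_rec 2 _ _ (fun _ r v => nth 1 v 0 + r)); try apply recursive_add;
      recursive_variable.
Qed.

Lemma recursive_sub (k : nat) (A B : list nat -> nat) :
  recursive k A -> recursive k B -> recursive k (fun v => A v - B v).
Proof.
  apply recursive_app2.
  apply recursive_ext with
    (fun v => nat_rec (fun _ => nat) (nth 0 v 0) (fun _ r => pred r) (nth 1 v 0)).
  - intros v _. induction (nth 1 v 0) as [| n IH]; cbn; [| rewrite IH]; lia.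
  - apply (recursive_rec 2 _ _ (fun _ r _ => pred r)); try apply recursive_pred;
      recursive_variable.
Qed.

Lemma recursive_pow2 (k : nat) (A : list nat -> nat) :
  recursive k A -> recursive k (fun v => 2 ^ A v).
Proof.
  apply recursive_app1.
  apply recursive_ext with
    (fun v => nat_rec (fun _ => nat) 1 (fun _ r => r + r) (nth 0 v 0)).
  - intros v _. induction (nth 0 v 0) as [| n IH]; cbn; [| rewrite IH]; lia.
  - apply (recursive_rec 1 _ _ (fun _ r _ => r + r)); try apply recursive_add;
      recursive_variable.
Qed.

Definition ifz (a b c : nat) : nat := match a with 0 => b | S _ => c end.

Lemma recursive_ifz (k : nat) (A B D : list nat -> nat) :
  recursive k A -> recursive k B -> recursive k D ->
  recursive k (fun v => ifz (A v) (B v) (D v)).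
Proof.
  apply recursive_app3.
  apply recursive_ext with
    (fun v => nat_rec (fun _ => nat) (nth 1 v 0) (fun _ _ => nth 2 v 0) (nth 0 v 0)).
  - intros v _. now destruct (nth 0 v 0).
  - apply (recursive_rec 3 _ _ (fun _ _ v => nth 2 v 0)); recursive_variable.
Qed.

(** Serves both as a bounded existential quantifier and as a counter. *)
Fixpoint bsum (n : nat) (F : nat -> nat) : nat :=
  match n with 0 => 0 | S n => F n + bsum n F end.

Lemma recursive_bsum (k : nat) (N : list nat -> nat) (F : nat -> list nat -> nat) :
  recursive k N -> recursive (S k) (fun w => F (hd 0 w) (tl w)) ->
  recursive k (fun v => bsum (N v) (fun i => F i v)).
Proof.
  intros HN HF.
  apply recursive_ext with
    (fun v => nat_rec (fun _ => nat) 0 (fun n r => F n v + r) (N v)).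
  - intros v _. induction (N v); cbn; congruence.
  - apply (recursive_rec k _ _ (fun n r v => F n v + r)); [exact HN | recursive_variable |].
    apply recursive_add; [| recursive_variable].
    now apply recursive_skip_second.
Qed.

Lemma bsum_pos (n : nat) (F : nat -> nat) :
  0 < bsum n F <-> exists i, i < n /\ 0 < F i.
Proof.
  induction n as [| n IH]; cbn.
  - split; [lia | intros (i & Hi & _); lia].
  - split.
    + intros H. destruct (F n) eqn:E.
      * destruct IH as [[i Hi] _]; [lia |]. exists i. intuition lia.
      * exists n. lia.
    + intros (i & Hi & HF). destruct (Nat.eq_dec i n) as [-> |]; [lia |].
      enough (0 < bsum n F) by lia. apply IH. exists i. lia.
Qed.

(** Tests are numbers, positive meaning true; conjunction is then multiplication. *)
Definition leb01 (a b : nat) : nat := 1 - (a - b).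
Definition eqb01 (a b : nat) : nat := leb01 a b * leb01 b a.

Lemma leb01_pos (a b : nat) : 0 < leb01 a b <-> a <= b.
Proof. unfold leb01. lia. Qed.

Lemma eqb01_pos (a b : nat) : 0 < eqb01 a b <-> a = b.
Proof. unfold eqb01. unfold leb01. destruct (a - b) eqn:?, (b - a) eqn:?; cbn; lia. Qed.

Lemma recursive_leb01 (k : nat) (A B : list nat -> nat) :
  recursive k A -> recursive k B -> recursive k (fun v => leb01 (A v) (B v)).
Proof.
  intros HA HB. apply (recursive_sub k (fun _ => 1) (fun v => A v - B v)).
  - apply recursive_const.
  - now apply recursive_sub.
Qed.

Lemma recursive_eqb01 (k : nat) (A B : list nat -> nat) :
  recursive k A -> recursive k B -> recursive k (fun v => eqb01 (A v) (B v)).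
Proof. intros HA HB. apply recursive_mul; now apply recursive_leb01. Qed.

Lemma pair_to_nat (p n : nat) : pair p n = Cantor.to_nat (p, n).
Proof.
  unfold pair. pose proof (Cantor.to_nat_spec p n) as H.
  enough ((p + n) * (p + n + 1) / 2 = Cantor.to_nat (p, n) - n) by lia.
  symmetry. apply Nat.div_unique with 0; lia.
Qed.

Lemma pair_inj (p n p' n' : nat) : pair p n = pair p' n' -> p = p' /\ n = n'.
Proof.
  rewrite !pair_to_nat. intros H. apply Cantor.to_nat_inj in H. now injection H.
Qed.

Lemma pair_ge (p n : nat) : p <= pair p n /\ n <= pair p n.
Proof.
  rewrite pair_to_nat. pose proof (Cantor.to_nat_non_decreasing p n). lia.
Qed.

Lemma recursive_pair (k : nat) (A B : list nat -> nat) :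
  recursive k A -> recursive k B -> recursive k (fun v => pair (A v) (B v)).
Proof.
  apply recursive_app2.
  (* Writing the triangular number as a sum avoids division. *)
  apply recursive_ext with
    (fun v => bsum (S (nth 0 v 0 + nth 1 v 0)) (fun i => i) + nth 1 v 0).
  - intros v _. unfold pair. f_equal.
    assert (forall m, 2 * bsum (S m) (fun i => i) = m * (m + 1)) as E.
    { induction m as [| m IH]; [reflexivity |].
      change (bsum (S (S m)) (fun i => i)) with (S m + bsum (S m) (fun i => i)). nia. }
    apply Nat.div_unique with 0; rewrite <- ?E; lia.
  - apply recursive_add; [apply (recursive_bsum 2 _ (fun i _ => i)) |].
    + apply recursive_S, recursive_add; recursive_variable.
    + recursive_variable.
    + recursive_variable.
Qed.

(** * Stage-bounded evaluation *)

(** Stands in for monotonicity in the stage: finitely many facts, each true from some stage on, are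
    true together at one stage. *)
Definition eventually (P : nat -> Prop) : Prop := exists t0, forall t, t0 <= t -> P t.

Lemma eventually_const (P : Prop) : P -> eventually (fun _ => P).
Proof. now exists 0. Qed.

Lemma eventually_ge (n : nat) : eventually (fun t => n <= t).
Proof. now exists n. Qed.

Lemma eventually_and2 (P Q R : nat -> Prop) :
  (forall t, P t -> Q t -> R t) -> eventually P -> eventually Q -> eventually R.
Proof.
  intros H [t1 H1] [t2 H2]. exists (max t1 t2).
  intros t Ht. apply H; [apply H1 | apply H2]; lia.
Qed.

Lemma eventually_mono (P Q : nat -> Prop) :
  (forall t, P t -> Q t) -> eventually P -> eventually Q.
Proof. intros H [t0 H0]. exists t0. auto. Qed.

Lemma eventually_list {A : Type} (P : A -> nat -> Prop) (l : list A) :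
  (forall a, In a l -> eventually (P a)) -> eventually (fun t => forall a, In a l -> P a t).
Proof.
  induction l as [| a l IH]; intros H.
  - exists 0. easy.
  - apply eventually_and2 with (P a) (fun t => forall a, In a l -> P a t).
    + intros t Ha Hl b [<- | Hb]; auto.
    + apply H. now left.
    + apply IH. intros b Hb. apply H. now right.
Qed.

(* [T t v] is [S y] when [t] stages suffice to find the value [y] of [f] at [v], else [0]. *)
Definition stages (k : nat) (f : prf) (T : nat -> list nat -> nat) : Prop :=
  recursive (S k) (fun w => T (hd 0 w) (tl w)) /\
  (forall t v y, length v = k -> T t v = S y -> eval f v y) /\
  (forall v y, length v = k -> eval f v y -> eventually (fun t => T t v = S y)).

Lemma stages_total (k : nat) (f : prf) (F : list nat -> nat) :
  recursive k F -> (forall v, length v = k -> eval f v (F v)) ->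
  stages k f (fun _ v => S (F v)).
Proof.
  intros HF Hf. split; [| split].
  - apply recursive_S, recursive_tl, HF.
  - intros t v y Hv [= <-]. auto.
  - intros v y Hv Hy. apply eventually_const. f_equal. eapply eval_functional; eauto.
Qed.

(** As 0 encodes divergence, this product is nonzero exactly when every component has converged. *)
Definition all_converge (Ts : list (nat -> list nat -> nat)) (t : nat) (v : list nat) : nat :=
  fold_right (fun T r => T t v * r) 1 Ts.

Lemma stages_comp (k : nat) (f : prf) (gs : list prf) (Tf : nat -> list nat -> nat)
    (Ts : list (nat -> list nat -> nat)) :
  stages (length gs) f Tf -> Forall2 (stages k) gs Ts ->
  stages k (pComp f gs)
    (fun t v => ifz (all_converge Ts t v) 0 (Tf t (map (fun T => pred (T t v)) Ts))).
Proof.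
  intros (Rf & Sf & Cf) HT. split; [| split].
  - apply recursive_ifz; [| apply recursive_const |].
    + clear - HT. induction HT as [| g T gs Ts (Rg & _) HT IH].
      * apply (recursive_const _ 1).
      * apply (recursive_mul _ _ (fun w => all_converge Ts (hd 0 w) (tl w))); assumption.
    + apply recursive_ext with
        (fun w => (fun u => Tf (hd 0 u) (tl u))
           (map (fun F => F w) (hd 0 :: map (fun T w => pred (T (hd 0 w) (tl w))) Ts))).
      { intros w _. cbn. now rewrite map_map. }
      apply (recursive_comp _ (hd 0 :: map (fun T w => pred (T (hd 0 w) (tl w))) Ts)
               (fun u => Tf (hd 0 u) (tl u))).
      * constructor; [recursive_variable |].
        clear - HT. induction HT as [| g T gs Ts (Rg & _) HT IH]; constructor; [| exact IH].
        now apply recursive_pred.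
      * cbn. rewrite length_map, <- (Forall2_length HT). exact Rf.
  - intros t v y Hv. destruct (all_converge Ts t v) as [| r] eqn:E; [discriminate |].
    cbn. intros Hy.
    assert (0 < all_converge Ts t v) as E0 by lia. clear r E.
    apply ev_comp with (map (fun T => pred (T t v)) Ts).
    + clear - HT E0 Hv. induction HT as [| g T gs Ts (_ & Sg & _) HT IH]; constructor.
      * apply (Sg t); [exact Hv |]. cbn in E0. destruct (T t v); [lia | reflexivity].
      * apply IH. cbn in E0. change (0 < T t v * all_converge Ts t v) in E0. nia.
    + apply (Sf t); [| exact Hy]. now rewrite length_map, (Forall2_length HT).
  - intros v y Hv Hy. inversion Hy as [| | | ? ? ? ys ? Hys Hfy | | |]; subst.
    assert (eventually (fun t => all_converge Ts t v <> 0 /\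
              map (fun T => pred (T t v)) Ts = ys)) as Hg.
    { clear - HT Hys. revert ys Hys.
      induction HT as [| g T gs Ts (_ & _ & Cg) HT IH]; intros ys Hys;
        inversion Hys as [| ? z ? zs Hz Hzs]; subst.
      - exists 0. now split.
      - eapply eventually_and2; [| apply (Cg _ _ eq_refl Hz) | apply (IH _ Hzs)].
        cbn. intros t -> [H1 ->]. split; [| reflexivity].
        change (S z * all_converge Ts t v <> 0). lia. }
    eapply eventually_and2; [| apply Hg | apply (Cf ys y)].
    + intros t [H1 ->] H2. now destruct (all_converge Ts t v).
    + symmetry. eapply Forall2_length, Hys.
    + exact Hfy.
Qed.

(** The accumulator holds the successor of the intermediate value; once it is 0 it stays 0, so a
    failure at any level is passed on. *)
Lemma stages_rec (k : nat) (f g : prf) (Tf Tg : nat -> list nat -> nat) :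
  stages k f Tf -> stages (S (S k)) g Tg ->
  stages (S k) (pRec f g)
    (fun t v => nat_rec (fun _ => nat) (Tf t (tl v))
       (fun n r => ifz r 0 (Tg t (n :: pred r :: tl v))) (hd 0 v)).
Proof.
  intros (Rf & Sf & Cf) (Rg & Sg & Cg). split; [| split].
  - apply (recursive_rec (S (S k)) (fun w => hd 0 (tl w)) (fun w => Tf (hd 0 w) (tl (tl w)))
             (fun n r w => ifz r 0 (Tg (hd 0 w) (n :: pred r :: tl (tl w))))).
    + recursive_variable.
    + now apply recursive_skip_second.
    + apply recursive_ifz; [recursive_variable | apply recursive_const |].
      apply recursive_ext with
        (fun w => (fun u => Tg (hd 0 u) (tl u))
           (map (fun F => F w) ((fun w => nth 2 w 0) :: (fun w => nth 0 w 0) ::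
              (fun w => pred (nth 1 w 0)) :: map (fun i w => nth i w 0) (seq 4 k)))).
      { intros [| n [| r [| t [| m v]]]] Hw; try discriminate. injection Hw as <-.
        cbn [map hd tl nth]. do 3 f_equal. rewrite map_map.
        rewrite <- (map_nth_seq_cons m v) at 2.
        now rewrite <- !(seq_shift (length v)), !map_map. }
      apply (recursive_comp _ ((fun w => nth 2 w 0) :: (fun w => nth 0 w 0) ::
              (fun w => pred (nth 1 w 0)) :: map (fun i w => nth i w 0) (seq 4 k))
              (fun u => Tg (hd 0 u) (tl u))).
      * do 3 (constructor; [try apply recursive_pred; recursive_variable |]).
        apply Forall_map, Forall_forall. intros i _. apply recursive_nth.
      * cbn. now rewrite length_map, length_seq.
  - intros t [| n v] y Hv; [discriminate |]. injection Hv as Hv. cbn.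
    revert y. induction n as [| n IH]; cbn; intros y Hy.
    + constructor. now apply (Sf t).
    + destruct (nat_rec _ _ _ n) as [| r]; [discriminate |].
      apply ev_recS with r; [now apply IH |]. apply (Sg t); cbn; [congruence | exact Hy].
  - intros [| n v] y Hv; [discriminate |]. injection Hv as Hv. cbn.
    revert y. induction n as [| n IH]; intros y Hy; cbn.
    + inversion Hy; subst. now apply Cf.
    + inversion Hy as [| | | | | ? ? ? ? r ? Hr Hgy |]; subst.
      eapply eventually_and2; [| apply (IH _ Hr) | apply (Cg (n :: r :: v) y eq_refl Hgy)].
      intros t -> <-. reflexivity.
Qed.

(* The state [mu_search T t v n] of the search after [n] steps is [0] while it goes on, [1]
   once it has met an argument at which [T t] has not converged, and [S (S m)] once it has
   found [m]. *)
Definition mu_step (T : nat -> list nat -> nat) (t : nat) (v : list nat) (j st : nat) : nat :=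
  ifz st (ifz (T t (j :: v)) 1 (ifz (pred (T t (j :: v))) (S (S j)) 0)) st.

Definition mu_search (T : nat -> list nat -> nat) (t : nat) (v : list nat) (n : nat) : nat :=
  nat_rec (fun _ => nat) 0 (mu_step T t v) n.

Lemma mu_search_S (T : nat -> list nat -> nat) (t : nat) (v : list nat) (n : nat) :
  mu_search T t v (S n) = mu_step T t v n (mu_search T t v n).
Proof. reflexivity. Qed.

Lemma mu_search_sound (T : nat -> list nat -> nat) (t : nat) (v : list nat) (n : nat) :
  (mu_search T t v n = 0 -> forall j, j < n -> 2 <= T t (j :: v)) /\
  (forall m, mu_search T t v n = S (S m) ->
     T t (m :: v) = 1 /\ forall j, j < m -> 2 <= T t (j :: v)).
Proof.
  induction n as [| n [IH0 IH1]]; [split; [lia | easy] |].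
  rewrite mu_search_S; unfold mu_step.
  destruct (mu_search T t v n) as [| st]; cbn.
  - specialize (IH0 eq_refl).
    destruct (T t (n :: v)) as [| [| y]] eqn:E; cbn.
    + now split.
    + split; [easy |]. intros m [= <-]. auto.
    + split; [| easy]. intros _ j Hj.
      destruct (Nat.eq_dec j n) as [-> |]; [lia | apply IH0; lia].
  - split; [easy | exact IH1].
Qed.

Lemma mu_search_found (T : nat -> list nat -> nat) (t : nat) (v : list nat) (m : nat) :
  T t (m :: v) = 1 -> (forall j, j < m -> 2 <= T t (j :: v)) ->
  forall n, m < n -> mu_search T t v n = S (S m).
Proof.
  intros Hm Hlt.
  assert (forall n, n <= m -> mu_search T t v n = 0) as H0.
  { induction n as [| n IH]; intros Hn; [reflexivity |].
    rewrite mu_search_S; unfold mu_step. rewrite IH by lia.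
    specialize (Hlt n ltac:(lia)). destruct (T t (n :: v)) as [| [|]]; [lia | lia | reflexivity]. }
  induction n as [| n IH]; intros Hn; [lia |].
  rewrite mu_search_S; unfold mu_step.
  destruct (Nat.eq_dec m n) as [<- |].
  - now rewrite H0, Hm.
  - now rewrite IH by lia.
Qed.

(** [pred] sends both the running and the failed search to 0 and a found [m] to [S m]. The stage [t]
    also bounds the length of the search. *)
Lemma stages_mu (k : nat) (f : prf) (T : nat -> list nat -> nat) :
  stages (S k) f T -> stages k (pMu f) (fun t v => pred (mu_search T t v t)).
Proof.
  intros (Rf & Sf & Cf). split; [| split].
  - apply recursive_pred.
    apply (recursive_rec (S k) (hd 0) (fun _ => 0) (fun j st w =>
      ifz st (ifz (T (hd 0 w) (j :: tl w)) 1 (ifz (pred (T (hd 0 w) (j :: tl w))) (S (S j)) 0)) st));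
      try recursive_variable.
    assert (recursive (S (S (S k)))
      (fun w => T (hd 0 (tl (tl w))) (hd 0 w :: tl (tl (tl w))))) as RT.
    { apply recursive_ext with
        (fun w => (fun u => T (hd 0 u) (tl u)) (map (fun i => nth i w 0) (2 :: 0 :: seq 3 k))).
      { intros [| j [| st [| t v]]] Hw; try discriminate. injection Hw as <-.
        cbn [map hd tl nth]. do 2 f_equal.
        rewrite <- (map_nth_seq_cons t v) at 2.
        now rewrite <- !(seq_shift (length v)), !map_map. }
      apply (recursive_reindex _ (2 :: 0 :: seq 3 k) (fun u => T (hd 0 u) (tl u))).
      cbn. now rewrite length_seq. }
    repeat first [apply recursive_ifz | apply recursive_S | apply recursive_pred
                 | exact RT | recursive_variable].
  - intros t v y Hv Hy. destruct (mu_search_sound T t v t) as [_ H].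
    destruct (H y) as [H1 H2]; [lia |]. constructor.
    + apply (Sf t); cbn; congruence.
    + intros m Hm. specialize (H2 m Hm). exists (pred (pred (T t (m :: v)))).
      apply (Sf t); cbn; [congruence | lia].
  - intros v y Hv Hy. inversion Hy as [| | | | | | ? ? ? H0 Hlt]; subst.
    assert (eventually (fun t => forall j, In j (seq 0 y) -> 2 <= T t (j :: v))) as E.
    { apply eventually_list. intros j Hj. apply in_seq in Hj.
      destruct (Hlt j) as [z Hz]; [lia |].
      eapply eventually_mono; [| apply (Cf (j :: v) (S z) eq_refl Hz)]. intros t ->. lia. }
    (* A search of [t] steps reaches [y] only if [y < t]. *)
    eapply eventually_and2; [| apply E | apply eventually_and2 with (3 := Cf (y :: v) 0 eq_refl H0)
      (1 := fun t H H' => conj H H'), (eventually_ge (S y))].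
    intros t H1 [H2 H3]. rewrite (mu_search_found T t v y); auto.
    intros j Hj. apply H1, in_seq. lia.
Qed.

Lemma stages_exist (f : prf) : forall k, exists T, stages k f T.
Proof.
  induction f as [| | i | f gs IHf IHgs | f g IHf IHg | f IHf] using prf_nested_ind; intros k.
  - eexists. apply (stages_total k pZero (fun _ => 0)); [apply recursive_const | constructor].
  - eexists. apply (stages_total k pSucc (fun v => S (hd 0 v)));
      [apply recursive_S; recursive_variable | constructor].
  - eexists. apply (stages_total k (pProj i) (fun v => nth i v 0));
      [apply recursive_nth | constructor].
  - destruct (IHf (length gs)) as [Tf HTf].
    assert (exists Ts, Forall2 (stages k) gs Ts) as [Ts HTs].
    { clear - IHgs. induction IHgs as [| g gs Hg _ [Ts HTs]]; [now exists [] |].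
      destruct (Hg k) as [T HT]. exists (T :: Ts). now constructor. }
    eexists. apply (stages_comp k f gs Tf Ts HTf HTs).
  (* No evaluation rule applies to [pRec] on the empty list, so at arity 0 the stages never
     converge. *)
  - destruct k as [| k].
    + exists (fun _ _ => 0). split; [| split].
      * apply recursive_const.
      * discriminate.
      * intros [| n v] y Hv Hy; [inversion Hy | discriminate].
    + destruct (IHf k) as [Tf HTf], (IHg (S (S k))) as [Tg HTg].
      eexists. apply (stages_rec k f g Tf Tg HTf HTg).
  - destruct (IHf (S k)) as [T HT]. eexists. apply (stages_mu k f T HT).
Qed.

(** * Computable selection of witnesses *)

Ltac recursive_step :=
  first [ recursive_variable
        | apply recursive_pair | apply recursive_leb01 | apply recursive_eqb01
        | apply recursive_pow2 | apply recursive_S | apply recursive_mul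
        | apply recursive_sub | apply recursive_add
        | apply recursive_bsum ].

Lemma recursive_of_computable1 (g : nat -> nat) :
  computable1 g -> recursive 1 (fun v => g (nth 0 v 0)).
Proof. intros [f Hf]. exists f. intros [| n [|]] Hv; easy || apply Hf. Qed.

Lemma recursive_of_computable3 (g : nat -> nat -> nat -> nat) :
  computable3 g -> recursive 3 (fun v => g (nth 0 v 0) (nth 1 v 0) (nth 2 v 0)).
Proof. intros [f Hf]. exists f. intros [| i [| k [| s [|]]]] Hv; easy || apply Hf. Qed.

Lemma recursive_selection (P : nat -> nat -> nat -> nat -> nat) :
  recursive 4 (fun v => P (nth 0 v 0) (nth 1 v 0) (nth 2 v 0) (nth 3 v 0)) ->
  (forall s, exists i m t, 0 < P s i m t) ->
  exists alpha, computable1 alpha /\ forall s, exists m t, 0 < P s (alpha s) m t.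
Proof.
  intros HP Hex.
  (* First search: a common bound [h] on [i], [m] and [t]. The term [1 - bsum] vanishes exactly when
     a witness lies below the bound. *)
  destruct (recursive_mu 1 (fun w => 1 - bsum (nth 0 w 0) (fun i => bsum (nth 0 w 0)
    (fun m => bsum (nth 0 w 0) (fun t => P (nth 1 w 0) i m t))))) as (h & Rh & Hh).
  { repeat first [recursive_step | apply (recursive_app4 _ P); [exact HP | ..]]. }
  { intros [| s v] Hv; [discriminate |]. destruct (Hex s) as (i & m & t & Hs).
    exists (S (max i (max m t))). cbn [nth].
    apply Nat.sub_0_le, bsum_pos. exists i. split; [lia |].
    apply bsum_pos. exists m. split; [lia |].
    apply bsum_pos. exists t. split; [lia | exact Hs]. }
  (* Second search: [i] alone, with [m] and [t] ranging below the bound already found. *)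
  destruct (recursive_mu 1 (fun w => 1 - bsum (h (tl w))
    (fun m => bsum (h (tl w)) (fun t => P (nth 1 w 0) (nth 0 w 0) m t)))) as (g & [f Hf] & Hg).
  { assert (recursive 3 (fun w => h (tl (tl w)))) as R3 
      by now apply (recursive_tl 2 (fun w => h (tl w))), recursive_tl.
    repeat first [recursive_step | apply (recursive_app4 _ P); [exact HP | ..]
                 | exact R3 | apply (recursive_tl 2 (fun w => h (tl w)))
                 | apply recursive_tl, Rh]. }
  { intros [| s v] Hv; [discriminate |]. specialize (Hh _ Hv). cbn [nth tl] in Hh |- *.
    apply Nat.sub_0_le, bsum_pos in Hh as (i & _ & Hi). exists i. now apply Nat.sub_0_le. }
  exists (fun s => g [s]). split.
  - exists f. intros n. now apply Hf.
  - intros s. specialize (Hg [s] eq_refl). cbn [nth tl] in Hg.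
    apply Nat.sub_0_le, bsum_pos in Hg as (m & _ & Hm).
    apply bsum_pos in Hm as (t & _ & Ht). eauto.
Qed.

(** * Plain complexity *)

Lemma code_surjective (n : nat) : exists s, code s = n.
Proof.
  induction n as [n IH] using lt_wf_ind.
  destruct n as [| n]; [now exists [] |].
  destruct (Nat.Even_or_Odd n) as [[k ->] | [k ->]];
    destruct (IH k) as [s Hs]; try lia;
    [exists (false :: s) | exists (true :: s)]; cbn; lia.
Qed.

(** [S (code (b :: s))] is twice [S (code s)] plus the bit [b], so [S (code s)] in binary is a
    leading 1 followed by the bits of [s] in reverse. *)
Lemma code_bounds (s : list bool) : 2 ^ length s <= S (code s) < 2 ^ S (length s).
Proof.
  induction s as [| b s IH]; cbn [length code]; [cbn; lia |].
  rewrite !Nat.pow_succ_r' in *. destruct b; lia.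
Qed.

Lemma optimal_length_le (U : machine) (V : machine) :
  optimal U -> partial_computable V ->
  exists c, forall s y, V s y -> exists t, U t y /\ length t <= length s + c.
Proof. intros [_ H] HV. now apply H. Qed.

Lemma optimal_code (U : machine) : optimal U ->
  exists c, forall s, exists t, U t (code s) /\ length t <= length s + c.
Proof.
  intros HU. destruct (optimal_length_le U (fun s y => y = code s) HU) as [c Hc].
  - exists (pProj 0). intros s y. split.
    + intros ->. apply (ev_proj 0 [code s]).
    + intros H. exact (eval_functional _ _ _ _ H (ev_proj 0 [code s])).
  - exists c. intros s. now apply Hc.
Qed.

(** [C] is an [epsilon] term, so a value must be shown to exist: by optimality [U] outputs every
    number, and a least program length exists classically. *)
Lemma C_is_C_value (U : machine) (HU : optimal U) (x : nat) : is_C_value U x (C U x).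
Proof.
  unfold C. apply epsilon_spec.
  destruct (code_surjective x) as [s <-].
  destruct (optimal_code U HU) as [c Hc]. destruct (Hc s) as (t & Ht & _).
  destruct (dec_inh_nat_subset_has_unique_least_element
              (fun k => exists s', U s' (code s) /\ length s' = k))
    as (k & [Hk Hmin] & _).
  - intros n. apply classic.
  - eauto.
  - exists k. split; [exact Hk |]. intros s' Hs'. apply Hmin. eauto.
Qed.

Lemma C_le (U : machine) (HU : optimal U) (s : list bool) (x : nat) :
  U s x -> C U x <= length s.
Proof. apply C_is_C_value, HU. Qed.

Lemma C_le_log2 (U : machine) (HU : optimal U) :
  exists c, forall m n, n < 2 ^ S m -> C U n <= m + c.
Proof.
  (* The extra 1 is due to strings of length [S m], the best bound that [n < 2 ^ S m] allows. *)
  destruct (optimal_code U HU) as [c Hc]. exists (S c). intros m n Hn.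
  destruct (code_surjective n) as [s <-]. destruct (Hc s) as (t & Ht & Hlen).
  pose proof (C_le U HU t _ Ht) as HC. pose proof (code_bounds s) as [Hs _].
  assert (length s <= S m); [| lia].
  apply Nat.pow_le_mono_r_iff with 2; lia.
Qed.

(** Consider the machine that runs [U] to obtain [n] and then outputs [pair (g n) n]. *)
Lemma C_graph_le (U : machine) (HU : optimal U) (g : nat -> nat) :
  computable1 g -> exists b, forall n, C U (pair (g n) n) <= C U n + b.
Proof.
  intros Hg.
  assert (recursive 1 (fun v => pair (g (nth 0 v 0)) (nth 0 v 0))) as [h Hh].
  { apply recursive_pair; [now apply recursive_of_computable1 | recursive_variable]. }
  destruct (optimal_length_le U (fun s y => exists n, U s n /\ y = pair (g n) n) HU) as [b Hb].
  - destruct HU as [[f Hf] _]. exists (pComp h [f]). intros s y. split.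
    + intros (n & Hn & ->). apply ev_comp with [n]; [| now apply (Hh [n])].
      repeat constructor. now apply Hf.
    + intros H. inversion H as [| | | ? ? ? ys ? Hys Hy | | |]; subst.
      inversion Hys as [| ? n ? zs Hn Hzs]; subst. inversion Hzs; subst.
      exists n. split; [now apply Hf |].
      exact (eval_functional _ _ _ _ Hy (Hh [n] eq_refl)).
  - exists b. intros n. destruct (C_is_C_value U HU n) as [(s & Hs & <-) _].
    destruct (Hb s (pair (g n) n)) as (t & Ht & Hlen); [eauto |].
    pose proof (C_le U HU t _ Ht). lia.
Qed.

(** Replaces strings by their codes, the form in which programs are counted. *)
Lemma C_program (U : machine) (HU : optimal U) (f : prf) (x m : nat) :
  (forall s y, U s y <-> eval f [code s] y) -> C U x <= m ->
  exists j, j < 2 ^ S m /\ eval f [j] x.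
Proof.
  intros Hf Hm. destruct (C_is_C_value U HU x) as [(s & Hs & Hlen) _].
  exists (code s). split; [| now apply Hf].
  pose proof (code_bounds s) as [_ Hb].
  pose proof (Nat.pow_le_mono_r 2 (S (length s)) (S m)). lia.
Qed.

(** * Counting *)

(** For [G n j] read: [j] is a program for level [n]. A program serves only one level, so programs
    chosen for different levels differ. *)
Lemma list_of_distinct_indices (G : nat -> nat -> Prop) (lo k : nat) :
  (forall n n' j, G n j -> G n' j -> n = n') ->
  (forall n, lo <= n < lo + k -> exists j, G n j) ->
  exists l, NoDup l /\ length l = k /\
    forall j, In j l -> exists n, lo <= n < lo + k /\ G n j.
Proof.
  intros Hfun. induction k as [| k IH]; intros Hex.
  - exists []. split; [constructor | easy].
  - destruct IH as (l & Hl & Hlen & HG); [intros n Hn; apply Hex; lia |].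
    destruct (Hex (lo + k)) as [j Hj]; [lia |].
    exists (j :: l). split; [| split].
    + constructor; [| exact Hl]. intros Hin. destruct (HG j Hin) as (n & Hn & Hnj).
      specialize (Hfun _ _ _ Hj Hnj). lia.
    + cbn. now f_equal.
    + intros j' [<- | Hin].
      * exists (lo + k). split; [lia | exact Hj].
      * destruct (HG j' Hin) as (n & Hn & Hnj). exists n. split; [lia | exact Hnj].
Qed.

Lemma bsum_count (N : nat) (F : nat -> nat) :
  bsum N (fun j => leb01 1 (F j)) = length (filter (fun j => 0 <? F j) (seq 0 N)).
Proof.
  induction N as [| N IH]; [reflexivity |].
  rewrite seq_S, filter_app, length_app, <- IH. cbn.
  destruct (F N); cbn; lia.
Qed.

Lemma bsum_count_ge (N : nat) (F : nat -> nat) (l : list nat) :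
  NoDup l -> (forall j, In j l -> j < N /\ 0 < F j) ->
  length l <= bsum N (fun j => leb01 1 (F j)).
Proof.
  intros Hl HF. rewrite bsum_count. apply NoDup_incl_length; [exact Hl |].
  intros j Hj. apply filter_In. destruct (HF j Hj). split.
  - apply in_seq. lia.
  - now apply Nat.ltb_lt.
Qed.

(* [W e m] is a subset of [0, 2^(m+b)); [K] is the limit as [e -> oo] of the
   [limsup] over [m] of the integer part of [#W e m / 2^m]. *)
Lemma asymptotic_density (W : nat -> nat -> nat -> Prop) (b : nat) :
  (forall e m j, W e m j -> j < 2 ^ (m + b)) ->
  exists K e0 m0,
    (forall e M, exists m l, M <= m /\ NoDup l /\ (forall j, In j l -> W e m j) /\
       K * 2 ^ m <= length l) /\
    (forall m l, m0 <= m -> NoDup l -> (forall j, In j l -> W e0 m j) ->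
       length l < S K * 2 ^ m).
Proof.
  intros HW.
  set (Q K := forall e M, exists m l, M <= m /\ NoDup l /\ (forall j, In j l -> W e m j) /\
                K * 2 ^ m <= length l).
  assert (exists K, Q K /\ ~ Q (S K)) as (K & HK & HK').
  { apply NNPP. intros Hno.
    assert (forall K, Q K) as HQ.
    { induction K as [| K IH].
      - intros e M. exists M, []. repeat split; [lia | constructor | easy | cbn; lia].
      - apply NNPP. intros HK. apply Hno. eauto. }
    (* More than [2 ^ b * 2 ^ m] distinct numbers do not fit below [2 ^ (m + b)]. *)
    destruct (HQ (S (2 ^ b)) 0 0) as (m & l & _ & Hl & Hin & Hlen).
    assert (length l <= length (seq 0 (2 ^ (m + b)))) as Hle.
    { apply NoDup_incl_length; [exact Hl |]. intros j Hj. apply in_seq.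
      specialize (HW _ _ _ (Hin j Hj)). lia. }
    rewrite length_seq, Nat.pow_add_r in Hle. pose proof (Nat.pow_nonzero 2 m). nia. }
  apply not_all_ex_not in HK' as [e0 HK']. apply not_all_ex_not in HK' as [m0 HK'].
  exists K, e0, m0. split; [exact HK |].
  intros m l Hm Hl Hin. apply Nat.nle_gt. intros Hle. apply HK'. now exists m, l.
Qed.

(** * Computable distances *)

Lemma half_pow_pos (n : nat) : (0 < (/2) ^ n)%R.
Proof. apply pow_lt. lra. Qed.

Lemma half_pow_S (n : nat) : ((/2) ^ n = (/2) ^ S n + (/2) ^ S n)%R.
Proof. cbn. lra. Qed.

Lemma half_pow_le (m n : nat) : m <= n -> ((/2) ^ n <= (/2) ^ m)%R.
Proof.
  induction 1 as [| n _ IH]; [apply Rle_refl |].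
  pose proof (half_pow_pos (S n)). pose proof (half_pow_S n). lra.
Qed.

Lemma half_pow_small (eps : R) : (0 < eps)%R -> eventually (fun n => ((/2) ^ n < eps)%R).
Proof.
  intros Heps. destruct (pow_lt_1_zero (/2)) with eps as [N HN].
  - rewrite Rabs_pos_eq; lra.
  - exact Heps.
  - exists N. intros n Hn. specialize (HN n Hn).
    rewrite Rabs_pos_eq in HN; [exact HN | left; apply half_pow_pos].
Qed.

(** The inequality of [near_pos] with denominators cleared. Its term [2^-s] absorbs the error of the
    rational approximation, so a positive answer certifies a distance below [2^-e]. *)
Definition near (num den : nat -> nat -> nat -> nat) (i k e s : nat) : nat :=
  leb01 (S ((num i k s * 2 ^ s + S (den i k s)) * 2 ^ e)) (S (den i k s) * 2 ^ s).

Lemma near_pos (num den : nat -> nat -> nat -> nat) (i k e s : nat) :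
  0 < near num den i k e s <->
  (INR (num i k s) / INR (S (den i k s)) + (/2) ^ s < (/2) ^ e)%R.
Proof.
  unfold near. rewrite leb01_pos.
  set (A := num i k s). set (D := S (den i k s)).
  change ((A * 2 ^ s + D) * 2 ^ e < D * 2 ^ s <->
    (INR A / INR D + (/2) ^ s < (/2) ^ e)%R).
  assert (0 < INR D)%R as HD by (apply lt_0_INR; unfold D; lia).
  assert (0 < 2 ^ s)%R as Hs by (apply pow_lt; lra).
  assert (0 < 2 ^ e)%R as He by (apply pow_lt; lra).
  assert (((INR A * 2 ^ s + INR D) * 2 ^ e < INR D * 2 ^ s)%R <->
          (INR A / INR D + (/2) ^ s < (/2) ^ e)%R) as H.
  { rewrite !pow_inv.
    replace ((INR A * 2 ^ s + INR D) * 2 ^ e)%R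
      with ((INR A / INR D + / 2 ^ s) * (INR D * 2 ^ s * 2 ^ e))%R by (field; lra).
    replace (INR D * 2 ^ s)%R with (/ 2 ^ e * (INR D * 2 ^ s * 2 ^ e))%R at 2 by (field; lra).
    assert (0 < INR D * 2 ^ s * 2 ^ e)%R by (repeat apply Rmult_lt_0_compat; assumption).
    split; intros Hlt; [now apply Rmult_lt_reg_r in Hlt | now apply Rmult_lt_compat_r]. }
  rewrite <- H. change 2%R with (INR 2). rewrite <- !pow_INR, <- !mult_INR, <- plus_INR, <- mult_INR.
  split; [apply lt_INR | apply INR_lt].
Qed.

Lemma recursive_near (k : nat) (num den : nat -> nat -> nat -> nat) (A B D E : list nat -> nat) :
  computable3 num -> computable3 den ->
  recursive k A -> recursive k B -> recursive k D -> recursive k E ->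
  recursive k (fun v => near num den (A v) (B v) (D v) (E v)).
Proof.
  intros Hn%recursive_of_computable3 Hd%recursive_of_computable3 HA HB HD HE.
  apply recursive_app4; try assumption. unfold near.
  repeat first [ apply (recursive_app3 _ num); [exact Hn | ..]
               | apply (recursive_app3 _ den); [exact Hd | ..] | recursive_step ].
Qed.

Lemma near_sound (num den : nat -> nat -> nat -> nat) (i k e s : nat) (r : R) :
  (Rabs (r - INR (num i k s) / INR (S (den i k s))) <= (/2) ^ s)%R ->
  0 < near num den i k e s -> (r < (/2) ^ e)%R.
Proof.
  intros Hr Hn%near_pos. pose proof (Rle_abs (r - INR (num i k s) / INR (S (den i k s)))). lra.
Qed.

Lemma near_complete (num den : nat -> nat -> nat -> nat) (i k e : nat) (r : R) :
  (forall s, Rabs (r - INR (num i k s) / INR (S (den i k s))) <= (/2) ^ s)%R ->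
  (r < (/2) ^ e)%R -> eventually (fun s => 0 < near num den i k e s).
Proof.
  intros Hr Hlt.
  (* Half the gap, since [2^-s] is spent twice: as approximation error and in the test. *)
  apply eventually_mono with (2 := half_pow_small (((/2) ^ e - r) / 2) ltac:(lra)).
  intros s Hs. apply near_pos. specialize (Hr s). rewrite Rabs_minus_sym in Hr.
  pose proof (Rle_abs (INR (num i k s) / INR (S (den i k s)) - r)). lra.
Qed.

(** * The search for approximations *)

(* [0] unless, by stage [t], program [j] has output some [<p,n>] with [2^m <= n < 2^(m+1)]
   and [q p] has been recognised to lie in [B(q i0, 2^-e0)] and in [B(q i, 2^-e)]. *)
Definition seen (num den : nat -> nat -> nat -> nat) (T : nat -> nat -> nat)
    (i0 e0 i e m t j : nat) : nat :=
  bsum (T t j) (fun p => bsum (T t j) (fun n =>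
    eqb01 (T t j) (S (pair p n)) * (leb01 (2 ^ m) n * (leb01 (S n) (2 ^ S m) *
      (near num den p i0 e0 t * near num den p i e t))))).

Lemma mul_pos (a b : nat) : 0 < a * b <-> 0 < a /\ 0 < b.
Proof. destruct a, b; cbn; lia. Qed.

Lemma seen_pos (num den : nat -> nat -> nat -> nat) (T : nat -> nat -> nat)
    (i0 e0 i e m t j : nat) :
  0 < seen num den T i0 e0 i e m t j <->
  exists p n, T t j = S (pair p n) /\ 2 ^ m <= n < 2 ^ S m /\
    0 < near num den p i0 e0 t /\ 0 < near num den p i e t.
Proof.
  unfold seen. rewrite bsum_pos. split.
  - intros (p & _ & Hp). apply bsum_pos in Hp as (n & _ & Hn). exists p, n.
    rewrite !mul_pos, eqb01_pos, !leb01_pos in Hn. tauto.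
  (* Both components are at most [pair p n], hence below [T t j], the range of the two sums. *)
  - intros (p & n & E & H). pose proof (pair_ge p n) as [Hp Hn].
    exists p. split; [lia |]. apply bsum_pos. exists n. split; [lia |].
    rewrite !mul_pos, eqb01_pos, !leb01_pos. tauto.
Qed.

(** The condition [e <= m] makes every level [n >= 2 ^ m] of block [m] finer than [2^-e]. *)
Definition many_seen (num den : nat -> nat -> nat -> nat) (T : nat -> nat -> nat)
    (b K m0 i0 e0 e i m t : nat) : nat :=
  leb01 m0 m * (leb01 e m * leb01 (K * 2 ^ m)
    (bsum (2 ^ (m + b)) (fun j => leb01 1 (seen num den T i0 e0 i e m t j)))).

Lemma recursive_many_seen (num den : nat -> nat -> nat -> nat) (T : nat -> nat -> nat)
    (b K m0 i0 e0 : nat) :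
  computable3 num -> computable3 den -> recursive 2 (fun v => T (nth 0 v 0) (nth 1 v 0)) ->
  recursive 4 (fun v => many_seen num den T b K m0 i0 e0
                          (nth 0 v 0) (nth 1 v 0) (nth 2 v 0) (nth 3 v 0)).
Proof.
  intros Hn Hd HT. unfold many_seen, seen.
  repeat first [ recursive_variable
               | apply (recursive_app2 _ T); [exact HT | ..]
               | apply recursive_near; [exact Hn | exact Hd | ..]
               | recursive_step ].
Qed.

Lemma computable_point_of_approximations (M : Type) (d : M -> M -> R) (q : nat -> M) (x : M)
    (HM : computable_metric_space M d q) (alpha : nat -> nat) :
  computable1 alpha -> (forall s, d x (q (alpha s)) < 2 * (/2) ^ s)%R ->
  computable_point M d q x.
Proof.
  destruct HM as (_ & _ & Hsym & Htri & _).
  (* After the shift by two the error at [s] is below half of [2^-s], so the errors at [s] and at a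
     later [t] add up to at most [2^-s]. *)
  intros Ha Hx. exists (fun s => alpha (S (S s))). split; [| split].
  - assert (recursive 1 (fun v => alpha (S (S (nth 0 v 0))))) as [f Hf].
    { apply (recursive_app1 1 alpha); [now apply recursive_of_computable1 |].
      repeat apply recursive_S. recursive_variable. }
    exists f. intros n. now apply (Hf [n]).
  - intros s t Hst.
    pose proof (Htri (q (alpha (S (S s)))) x (q (alpha (S (S t))))) as H.
    rewrite (Hsym _ x) in H.
    pose proof (Hx (S (S s))) as H1. pose proof (Hx (S (S t))) as H2.
    pose proof (half_pow_le s t Hst). cbn in H1, H2. lra.
  - intros eps Heps. destruct (half_pow_small eps Heps) as [N HN].
    exists N. intros s Hs. rewrite Hsym.
    pose proof (Hx (S (S s))) as H. specialize (HN s Hs). pose proof (half_pow_pos s).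
    cbn in H. lra.
Qed.

Lemma computable_point_of_short_programs (M : Type) (d : M -> M -> R) (q : nat -> M) (x : M)
    (HM : computable_metric_space M d q) (f : prf) (b : nat) :
  (forall m n, 2 ^ m <= n < 2 ^ S m -> exists p j,
     j < 2 ^ (m + b) /\ eval f [j] (pair p n) /\ (d x (q p) < (/2) ^ n)%R) ->
  computable_point M d q x.
Proof.
  intros Hshort.
  pose proof HM as (_ & _ & Hsym & Htri & _ & Hdense & num & den & Hnum & Hden & Hdist).
  destruct (stages_exist f 1) as (T & HT & Tsound & Tcomplete).
  pose (T1 t j := T t [j]).
  assert (recursive 2 (fun v => T1 (nth 0 v 0) (nth 1 v 0))) as HT1.
  { apply recursive_ext with (2 := HT). intros [| t [| j [|]]] Hv; easy. }
  (* The constants [K], [e0], [m0] and below [i0] are obtained non-effectively; the search only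
     needs them as fixed parameters. *)
  destruct (asymptotic_density (fun e m j => j < 2 ^ (m + b) /\ exists p n,
      eval f [j] (pair p n) /\ 2 ^ m <= n < 2 ^ S m /\ (d x (q p) < (/2) ^ e)%R) b)
    as (K & e0 & m0 & Hmany & Hfew); [tauto |].
  (* With this centre, the ball of radius [2^-(e0+1)] contains B(x, 2^-(e0+2)) and lies in B(x,
     2^-e0). *)
  destruct (Hdense x ((/2) ^ S (S e0))%R (half_pow_pos _)) as [i0 Hi0].
  (* Besides [m >= m0], the search asks for [m >= e0], so that levels in block [m] are finer than
     [2^-e0]. *)
  destruct (recursive_selection (many_seen num den T1 b K (max m0 e0) i0 (S e0)))
    as (alpha & Halpha & Hfound).
  { now apply recursive_many_seen. }
  { intros s. destruct (Hdense x ((/2) ^ S s)%R (half_pow_pos _)) as [i Hi].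
    (* At this precision each output point is within [2^-(e0+1)] of [q i0] and within [2^-s] of
       [q i], so every program of the finite list [l] is eventually seen. *)
    destruct (Hmany (S (S (max e0 s))) (max s (max m0 e0))) as (m & l & Hm & Hl & Hin & Hlen).
    assert (eventually (fun t => forall j, In j l ->
              0 < seen num den T1 i0 (S e0) i s m t j)) as [t Ht].
    { apply eventually_list. intros j Hj.
      destruct (Hin j Hj) as (_ & p & n & Hp & Hn & Hxp).
      pose proof (half_pow_le (S (S e0)) (S (S (max e0 s))) ltac:(lia)).
      pose proof (half_pow_le (S s) (S (S (max e0 s))) ltac:(lia)).
      pose proof (Htri (q p) x (q i0)) as Hp0. pose proof (Htri (q p) x (q i)) as Hp1.
      rewrite (Hsym (q p) x) in Hp0, Hp1.
      pose proof (half_pow_S (S e0)). pose proof (half_pow_S s).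
      eapply eventually_and2; [| apply (Tcomplete [j] _ eq_refl Hp) |
        eapply eventually_and2; [| apply (near_complete num den p i0 (S e0) (d (q p) (q i0)))
                                 | apply (near_complete num den p i s (d (q p) (q i)))]].
      - intros t Ht Hnear. apply seen_pos. exists p, n. split; [exact Ht |].
        split; [exact Hn | exact Hnear].
      - intros t Hn0 Hn1. exact (conj Hn0 Hn1).
      - auto.
      - lra.
      - auto.
      - lra. }
    exists i, m, t. unfold many_seen. rewrite !mul_pos, !leb01_pos.
    split; [lia |]. split; [lia |]. etransitivity; [exact Hlen |].
    apply bsum_count_ge; [exact Hl |]. intros j Hj. split.
    - now apply Hin.
    - apply (Ht t); [lia | exact Hj]. }
  apply (computable_point_of_approximations M d q x HM alpha Halpha).
  intros s. destruct (Hfound s) as (m & t & Hmt).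
  unfold many_seen in Hmt. rewrite !mul_pos, !leb01_pos, bsum_count in Hmt.
  destruct Hmt as (Hm0 & Hs & Hcount).
  set (l := filter _ _) in Hcount.
  assert (m < 2 ^ m) as Hm by (apply Nat.pow_gt_lin_r; lia).
  apply NNPP. intros Hfar.
  (* Otherwise the programs for the [2^m] approximations of [x] at the levels [n] of block [m]
     are all outside [l], which makes the block too dense. *)
  destruct (list_of_distinct_indices (fun n j => j < 2 ^ (m + b) /\ exists p,
      eval f [j] (pair p n) /\ (d x (q p) < (/2) ^ n)%R) (2 ^ m) (2 ^ m))
    as (l' & Hl' & Hlen' & Hin').
  { intros n n' j (_ & p & Hp & _) (_ & p' & Hp' & _).
    now apply (pair_inj p n p' n'), (eval_functional f [j]). }
  { intros n Hn. destruct (Hshort m n) as (p & j & Hj & Hp & Hxp); [cbn; lia |]. eauto. }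
  (* [l] has at least [K * 2 ^ m] entries and [l'] has [2 ^ m], against this bound. *)
  assert (length (l ++ l') < S K * 2 ^ m); [| rewrite length_app in *; lia].
  apply Hfew; [lia | |].
  (* A common program would output a point within [2^-s] of [q (alpha s)] and within [2^-n <= 2^-s]
     of [x], contradicting [Hfar]. *)
  - apply NoDup_app; [apply NoDup_filter, seq_NoDup | exact Hl' |].
    intros j Hj Hj'. apply filter_In in Hj as [_ Hj%Nat.ltb_lt].
    apply seen_pos in Hj as (p & n & HTp & _ & _ & Hnear).
    apply Tsound in HTp; [| reflexivity].
    destruct (Hin' j Hj') as (n' & Hn' & _ & p' & Hp' & Hxp).
    destruct (pair_inj p n p' n') as [<- <-]; [now apply (eval_functional f [j]) |].
    apply (near_sound _ _ _ _ _ _ (d (q p) (q (alpha s)))) in Hnear; [| auto].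
    apply Hfar. pose proof (Htri x (q p) (q (alpha s))).
    pose proof (half_pow_le s n ltac:(lia)). lra.
  (* Closeness to [x] up to [2^-e0] comes from the ball around [q i0] for [l], and from
     [e0 <= m < 2 ^ m <= n] for [l']. *)
  - intros j [Hj | Hj]%in_app_iff.
    + apply filter_In in Hj as [Hjb%in_seq Hj%Nat.ltb_lt]. split; [lia |].
      apply seen_pos in Hj as (p & n & HTp & Hn & Hnear & _).
      apply Tsound in HTp; [| reflexivity].
      exists p, n. split; [exact HTp |]. split; [exact Hn |].
      apply (near_sound _ _ _ _ _ _ (d (q p) (q i0))) in Hnear; [| auto].
      pose proof (Htri x (q i0) (q p)) as H. rewrite (Hsym (q i0)) in H.
      pose proof (half_pow_S e0). pose proof (half_pow_S (S e0)).
      pose proof (half_pow_pos (S (S e0))). lra.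
    + destruct (Hin' j Hj) as (n & Hn & Hjb & p & Hp & Hxp). split; [exact Hjb |].
      exists p, n. split; [exact Hp |]. split; [cbn; lia |].
      pose proof (half_pow_le e0 n ltac:(lia)). lra.
Qed.

(** * The equivalence *)

Open Scope R_scope.

Theorem mainTheorem19 (M : Type) (d : M -> M -> R) (q : nat -> M)
  (HM : computable_metric_space M d q) (U : machine) (HU : optimal U) (x : M) :
  computable_point M d q x <-> locally_C_trivial U M d q x.
Proof.
  split.
  - intros (alpha & Halpha & Hcauchy & Hlim).
    pose proof HM as (_ & _ & Hsym & Htri & _).
    destruct (C_graph_le U HU (fun n => alpha (S n))) as [b Hb].
    { assert (recursive 1 (fun v => alpha (S (nth 0 v 0%nat)))) as [f Hf].
      { apply (recursive_app1 1 alpha); [now apply recursive_of_computable1 |].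
        apply recursive_S. recursive_variable. }
      exists f. intros n. now apply (Hf [n]). }
    (* The Cauchy bound at [S n] is not strict; the limit supplies a strict bound [2^-(n+1)] for the
       remaining distance. *)
    exists b. intros n. exists (alpha (S n)). split; [| apply Hb].
    destruct (Hlim _ (half_pow_pos (S n))) as [N HN].
    specialize (HN (max N (S n)) ltac:(lia)).
    specialize (Hcauchy (S n) (max N (S n)) ltac:(lia)).
    pose proof (Htri (q (alpha (S n))) (q (alpha (max N (S n)))) x) as H.
    rewrite (half_pow_S n), Hsym. lra.
  - intros [b Hb]. pose proof HU as [[f Hf] _].
    destruct (C_le_log2 U HU) as [c Hc].
    (* [C U (pair p n) <= C U n + b <= m + c + b], and codes of strings of length at most [k] are
       below [2 ^ S k]. *)
    apply (computable_point_of_short_programs M d q x HM f (S (c + b))).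
    intros m n Hn. destruct (Hb n) as (p & Hxp & HC). exists p.
    specialize (Hc m n ltac:(lia)).
    destruct (C_program U HU f (pair p n) (m + (c + b)) Hf) as (j & Hj & Hp); [lia |].
    exists j. rewrite Nat.add_succ_r. auto.
Qed.
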